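(* Let $\mathcal{A},\mathcal{Z}\in\mathbb{R}^{n\times n}$ be lattice bases with $\mathbb{L}(\mathcal{Z})\subset\mathbb{L}(\mathcal{A})$ and let $\mathfrak{s}=(\mathfrak{s}_1,\ldots,\mathfrak{s}_m)$ be a structure element. An orthonormal basis of the function space $\mathcal{L}(T^{\mathfrak{s}}_{\mathcal{A},\mathcal{Z}})$ is given by the wave functions $e_{1,k},e_{2,k},\ldots,e_{m,k}$ with $k\in T^*_{\mathcal{A},\mathcal{Z}}:=\mathbb{L}(\mathcal{Z})^*/\mathbb{L}(\mathcal{A})^*$, defined by $$\left(e_{\ell,k}(x)\right)_j:=\begin{cases}e^{2\pi i\langle k,x\rangle} & \text{if } j=\ell,\\ 0 & \text{else,}\end{cases}\qquad j,\ell\in\{1,\ldots,m\},\ x\in T_{\mathcal{A},\mathcal{Z}}.$$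
   Context: A lattice basis is an invertible matrix $\mathcal{A}\in\mathbb{R}^{n\times n}$; its lattice is $\mathbb{L}(\mathcal{A})=\mathcal{A}\mathbb{Z}^n$. A structure element $\mathfrak{s}=(\mathfrak{s}_1,\ldots,\mathfrak{s}_m)$ is a tuple of points of a primitive cell of $\mathbb{L}(\mathcal{A})$ (a volume of $\mathbb{R}^n$ whose $\mathbb{L}(\mathcal{A})$-translates tile $\mathbb{R}^n$ without overlap); $|\mathfrak{s}|=m$. For $\mathbb{L}(\mathcal{Z})\subset\mathbb{L}(\mathcal{A})$, $T_{\mathcal{A},\mathcal{Z}}=\mathbb{L}(\mathcal{A})/\mathbb{L}(\mathcal{Z})$ is the (finite) lattice torus; $T^{\mathfrak{s}}_{\mathcal{A},\mathcal{Z}}$ is the crystal torus, consisting of the classes modulo $\mathbb{L}(\mathcal{Z})$ of $x+\mathfrak{s}=(x+\mathfrak{s}_1,\ldots,x+\mathfrak{s}_m)$, $x\in\mathbb{L}(\mathcal{A})$. The function space is $\mathcal{L}(T^{\mathfrak{s}}_{\mathcal{A},\mathcal{Z}})=\{f=(f_1,\ldots,f_m):T_{\mathcal{A},\mathcal{Z}}\to\mathbb{C}^{m}\}$ (the value $f_j(x)$ being attached to position $x+\mathfrak{s}_j$), with scalar product $$\langle f,g\rangle=\frac{1}{|T_{\mathcal{A},\mathcal{Z}}|}\sum_{x\in T_{\mathcal{A},\mathcal{Z}}}\sum_{\ell=1}^m f_\ell(x)\overline{g_\ell(x)}.$$ The dual lattice is $\mathbb{L}(\mathcal{A})^*=\{k\in\mathbb{R}^n:\langle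 k,x\rangle\in\mathbb{Z}\text{ for all }x\in\mathbb{L}(\mathcal{A})\}$, which has lattice basis $\mathcal{A}^{-T}$. Elements of quotient groups are identified with representatives. *)

(* Defs.v *)
From HB Require Import structures.
From mathcomp Require Import all_boot all_order all_algebra finmap complex.
From mathcomp Require Import all_classical all_reals all_analysis.

Set Implicit Arguments.
Unset Strict Implicit.
Unset Printing Implicit Defensive.

Import Order.TTheory GRing.Theory Num.Theory.

Local Open Scope classical_set_scope.
Local Open Scope ring_scope.

Definition dotv (R : realType) (n : nat) (k x : 'cV[R]_n) : R :=
  \sum_(i < n) k i 0 * x i 0.

(* A Z^n; A \in unitmx is a separate hypothesis. *)
Definition lattice (R : realType) (n : nat) (A : 'M[R]_n) : set 'cV[R]_n :=
  [set A *m map_mx intr z | z in [set: 'cV[int]_n]].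

Definition dual (R : realType) (n : nat) (L : set 'cV[R]_n) : set 'cV[R]_n :=
  [set k | forall x, L x -> dotv k x \is a Num.int].

(* The translates a + P, a in L, partition R^n ("without overlap" is read as
   disjointness, so P contains only one of two faces identified by L). No
   regularity is imposed on P; any finite tuple of points of such a P also lies
   in a Borel cell, since a cell may be changed at finitely many points. *)
Definition primitive_cell (R : realType) (n : nat) (L P : set 'cV[R]_n) : Prop :=
  forall x, exists! a, L a /\ P (x - a).

Definition structure_element (R : realType) (n m : nat) (A : 'M[R]_n)
    (s : m.-tuple 'cV[R]_n) : Prop :=
  exists P, primitive_cell (lattice A) P /\ forall j, P (tnth s j).

Definition quotient (V : zmodType) (L M : set V) : set (set V) :=
  [set [set x + y | y in M] | x in L].

(* fset_set turns a finite set into an {fset _}, hence into a finType, but it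
   maps infinite sets to fset0: see set_torus and set_dual_torus below. *)
Definition torus (R : realType) (n : nat) (A Z : 'M[R]_n) : {fset set 'cV[R]_n} :=
  fset_set (quotient (lattice A) (lattice Z)).

Definition dual_torus (R : realType) (n : nat) (A Z : 'M[R]_n) :
    {fset set 'cV[R]_n} :=
  fset_set (quotient (dual (lattice Z)) (dual (lattice A))).

Definition rep (R : realType) (n : nat) (X : set 'cV[R]_n) : 'cV[R]_n := xget 0 X.

(* The functions T_{A,Z} -> C^m; s only determines m, the value f X 0 j being
   attached to the position (representative of X) + s_j. *)
Definition crystal_fun (R : realType) (n m : nat) (A Z : 'M[R]_n)
    (s : m.-tuple 'cV[R]_n) := {ffun torus A Z -> 'rV[R[i]]_m}.

Definition crystal_dot (R : realType) (n m : nat) (A Z : 'M[R]_n)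
    (s : m.-tuple 'cV[R]_n) (f g : crystal_fun A Z s) : R[i] :=
  (#|` torus A Z|)%:R^-1 *
    \sum_(X : torus A Z) \sum_(l < m) f X 0 l * (g X 0 l)^*.

(* e^{i t} *)
Definition expi (R : realType) (t : R) : R[i] := (cos t +i* sin t)%C.

(* wave_torusE below shows independence of the representatives. *)
Definition wave (R : realType) (n m : nat) (A Z : 'M[R]_n)
    (s : m.-tuple 'cV[R]_n) (l : 'I_m) (K : dual_torus A Z) :
    crystal_fun A Z s :=
  [ffun X : torus A Z => \row_j
    if j == l then expi (2 * pi * dotv (rep (val K)) (rep (val X))) else 0].

Lemma dotvE (R : realType) (n : nat) (k x : 'cV[R]_n) :
  dotv k x = (k^T *m x) 0 0.
Proof. by rewrite /dotv mxE; apply: eq_bigr => i _; rewrite mxE. Qed.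

Lemma dotv_mul (R : realType) (n : nat) (A : 'M[R]_n) (k y : 'cV[R]_n) :
  dotv k (A *m y) = dotv (A^T *m k) y.
Proof. by rewrite !dotvE trmx_mul trmxK mulmxA. Qed.

Lemma dotvC (R : realType) (n : nat) (k x : 'cV[R]_n) : dotv k x = dotv x k.
Proof. by apply: eq_bigr => i _; rewrite mulrC. Qed.

Lemma dotvBr (R : realType) (n : nat) (k x y : 'cV[R]_n) :
  dotv k (x - y) = dotv k x - dotv k y.
Proof. by rewrite !dotvE mulmxBr !mxE. Qed.

Lemma dotvDr (R : realType) (n : nat) (k x y : 'cV[R]_n) :
  dotv k (x + y) = dotv k x + dotv k y.
Proof. by rewrite !dotvE mulmxDr !mxE. Qed.

Lemma dotv_int (R : realType) (n : nat) (y z : 'cV[int]_n) :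
  dotv (map_mx intr y : 'cV[R]_n) (map_mx intr z) \is a Num.int.
Proof. by apply: rpred_sum => i _; rewrite !mxE rpredM ?intr_int. Qed.

Lemma lattice_sub (R : realType) (n : nat) (A : 'M[R]_n) (x y : 'cV[R]_n) :
  lattice A x -> lattice A y -> lattice A (x - y).
Proof.
move=> [u _ <-] [v _ <-]; exists (u - v) => //.
by rewrite map_mxB mulmxBr.
Qed.

Lemma lattice_add (R : realType) (n : nat) (A : 'M[R]_n) (x y : 'cV[R]_n) :
  lattice A x -> lattice A y -> lattice A (x + y).
Proof.
move=> [u _ <-] [v _ <-]; exists (u + v) => //.
by rewrite map_mxD mulmxDr.
Qed.

Lemma dual_lattice (R : realType) (n : nat) (A : 'M[R]_n) : A \in unitmx ->
  dual (lattice A) = lattice (invmx A)^T.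
Proof.
move=> uA; apply/seteqP; split=> k.
  move=> Lk.
  have AkZ i : (A^T *m k) i 0 \is a Num.int.
    have := Lk _ (ex_intro2 _ _ (delta_mx i 0 : 'cV[int]_n) I erefl).
    by rewrite map_delta_mx dotv_mul dotvE -colE !mxE.
  exists (map_mx Num.floor (A^T *m k)) => //.
  have -> : map_mx intr (map_mx Num.floor (A^T *m k)) = A^T *m k.
    apply/matrixP => i j; rewrite [LHS]mxE [X in X%:~R]mxE ord1.
    by rewrite floorK.
  by rewrite trmx_inv mulKmx // unitmx_tr.
move=> [z _ <-] x [y _ <-].
by rewrite dotv_mul trmx_inv mulKVmx ?unitmx_tr // dotv_int.
Qed.

Lemma coset_eq (R : realType) (n : nat) (Z : 'M[R]_n) (x y : 'cV[R]_n) :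
  lattice Z (x - y) ->
  [set x + v | v in lattice Z] = [set y + v | v in lattice Z].
Proof.
move=> Lxy; apply/seteqP; split=> _ [v Lv <-].
  by exists (x - y + v); [exact: lattice_add|rewrite addrA (addrC y) subrK].
exists (v - (x - y)); first exact: lattice_sub.
by rewrite addrCA subKr addrC.
Qed.

Lemma finite_quotient (R : realType) (n : nat) (A Z : 'M[R]_n) :
  A \in unitmx -> Z \in unitmx -> lattice Z `<=` lattice A ->
  finite_set (quotient (lattice A) (lattice Z)).
Proof.
move=> uA uZ ZA.
have /choice[z zE] : forall j : 'I_n, exists z : 'cV[int]_n,
    A *m map_mx intr z = col j Z.
  move=> j; have [|z _ <-] := ZA (col j Z); last by exists z.
  exists (delta_mx j 0) => //.
  by rewrite map_delta_mx -colE.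
pose M := \matrix_(i, j) z j i 0.
have ZE : Z = A *m map_mx intr M.
  apply/matrixP => i j; have /matrixP/(_ i 0) := zE j.
  rewrite [RHS]mxE => <-; rewrite !mxE; apply: eq_bigr => k _.
  by rewrite !mxE.
pose d := \det M.
have d0 : d != 0.
  move: uZ; rewrite ZE unitmx_mul => /andP[_].
  by rewrite unitmxE det_map_mx unitfE intr_eq0.
pose f (u : 'cV['I_(`|d|%N)]_n) :=
  [set A *m map_mx intr (map_mx (fun i : 'I__ => (i : nat)%:Z) u) + v | v in lattice Z].
apply: (@sub_finite_set _ _ (range f)); last first.
  by apply: finite_image; exact: finite_finset.
move=> _ [_ [y _ <-] <-].
have yd i : (`|(y i ord0 %% d)%Z| < `|d|)%N.
  rewrite -ltz_nat gez0_abs ?modz_ge0 // abszE; exact: ltz_mod.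
exists (\col_i Ordinal (yd i)) => //.
rewrite /f; apply: coset_eq; rewrite -mulmxBr -map_mxB.
pose q : 'cV[int]_n := \col_i (- (y i ord0 %/ d)%Z).
exists (\adj M *m q) => //.
rewrite ZE -mulmxA -map_mxM mulmxA mul_mx_adj mul_scalar_mx.
congr (_ *m map_mx _ _); apply/matrixP => i j.
rewrite !mxE /= ord1 gez0_abs ?modz_ge0 //.
have -> : y i j = y i ord0 by rewrite [j]ord1.
rewrite [X in _ - X](divz_eq (y i ord0) d) opprD addrCA subrr addr0.
by rewrite mulrN mulrC.
Qed.

Lemma dual_sub (R : realType) (n : nat) (L M : set 'cV[R]_n) :
  L `<=` M -> dual M `<=` dual L.
Proof. by move=> LM k kM x /LM; exact: kM. Qed.

Lemma set_torus (R : realType) (n : nat) (A Z : 'M[R]_n) :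
  A \in unitmx -> Z \in unitmx -> lattice Z `<=` lattice A ->
  [set` torus A Z] = quotient (lattice A) (lattice Z).
Proof. by move=> uA uZ ZA; rewrite fset_setK //; exact: finite_quotient. Qed.

Lemma set_dual_torus (R : realType) (n : nat) (A Z : 'M[R]_n) :
  A \in unitmx -> Z \in unitmx -> lattice Z `<=` lattice A ->
  [set` dual_torus A Z] = quotient (dual (lattice Z)) (dual (lattice A)).
Proof.
move=> uA uZ ZA; rewrite fset_setK //.
have := dual_sub ZA; rewrite !dual_lattice // => AZ.
by apply: finite_quotient => //; rewrite unitmx_tr unitmx_inv.
Qed.

Lemma expi_int (R : realType) (t u : R) : t - u \is a Num.int ->
  expi (2 * pi * t) = expi (2 * pi * u).
Proof.
move=> /intrP[z tu].
have expin (v : R) (k : nat) : expi (2 * pi * (v + k%:R)) = expi (2 * pi * v).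
  rewrite mulrDr (_ : 2 * pi * k%:R = pi *+ 2 *+ k).
    by rewrite /expi (periodicn (@cosD2pi R)) (periodicn (@sinD2pi R)).
  by rewrite mulr_natr mulr_natl.
have -> : t = u + z%:~R by rewrite -tu addrC subrK.
case: z {tu} => k; first exact: expin.
by rewrite NegzE mulrNz -[in RHS](subrK k.+1%:R u) expin.
Qed.

Lemma coset_rep (R : realType) (n : nat) (L : set 'cV[R]_n) (A : 'M[R]_n)
    (X : set 'cV[R]_n) (x : 'cV[R]_n) :
  quotient L (lattice A) X -> X x -> lattice A (rep X - x).
Proof.
move=> [w _ <-] Xx.
have : [set w + y | y in lattice A] (rep [set w + y | y in lattice A]).
  by rewrite /rep; apply: xgetPex; exists x.
case: Xx => u Lu <- [v Lv <-].
by rewrite opprD addrACA subrr add0r; exact: lattice_sub.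
Qed.

Lemma wave_torusE (R : realType) (n m : nat) (A Z : 'M[R]_n)
    (s : m.-tuple 'cV[R]_n) (l : 'I_m) (K : dual_torus A Z) (X : torus A Z)
    (k x : 'cV[R]_n) :
  A \in unitmx -> Z \in unitmx -> lattice Z `<=` lattice A ->
  val K k -> val X x ->
  wave s l K X = \row_j if j == l then expi (2 * pi * dotv k x) else 0.
Proof.
move=> uA uZ ZA Kk Xx; rewrite ffunE; apply/rowP => j; rewrite !mxE.
case: eqP => // _; apply: expi_int.
have QX : quotient (lattice A) (lattice Z) (val X).
  by rewrite -set_torus //; exact: (valP X).
have QK : quotient (dual (lattice Z)) (dual (lattice A)) (val K).
  by rewrite -set_dual_torus //; exact: (valP K).
have dX := coset_rep QX Xx.
have dK : dual (lattice A) (rep (val K) - k).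
  by move: QK; rewrite (dual_lattice uA) => QK; exact: coset_rep QK Kk.
have Zk : dual (lattice Z) k.
  case: QK Kk => k0 Zk0 <- [k1 Ak1 <-] y Zy.
  by rewrite dotvC dotvDr; apply: rpredD; rewrite dotvC; [exact: Zk0|apply: Ak1; exact: ZA].
have Ax : lattice A (rep (val X)).
  case: QX Xx dX => x0 Ax0 <- [x1 Zx1 <-] dX.
  rewrite -[rep _](subrK (x0 + x1)); apply: lattice_add; first exact: ZA.
  by apply: lattice_add => //; exact: ZA.
rewrite -[dotv (rep _) _](subrK (dotv k (rep (val X)))) -addrA; apply: rpredD.
  by rewrite dotvC (dotvC k) -dotvBr dotvC; exact: dK.
by rewrite -dotvBr; exact: Zk.
Qed.

(* Main.v *)
(* Orthonormality is the orthogonality of characters: if [k] is in the dual of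
   L(Z) but not in the dual of L(A), some [a] in L(A) has [<k, a>] not an
   integer, and translating by [a] shows that the sum of [e^{2 pi i <k, x>}]
   over the torus vanishes. Hence the waves are linearly independent, which for
   [m = 1] gives |T*| <= |T|. Duality exchanges the two tori, so |T*| = |T| and
   the waves are as many as the dimension. *)
Require Import Defs.
From mathcomp Require Import all_boot all_order all_algebra finmap complex.
From mathcomp Require Import all_classical all_reals all_analysis.
From mathcomp Require Import lra.

Set Implicit Arguments.
Unset Strict Implicit.
Unset Printing Implicit Defensive.

Import Order.TTheory GRing.Theory Num.Theory.

Local Open Scope classical_set_scope.
Local Open Scope ring_scope.

Lemma expiD (R : realType) (t u : R) : expi (t + u) = expi t * expi u.
Proof.
by rewrite /expi cosD sinD; apply/eqP; rewrite eq_complex /= eqxx addrC eqxx.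
Qed.

Lemma expi_conj (R : realType) (t : R) : (expi t)^* = expi (- t).
Proof. by rewrite /expi cosN sinN. Qed.

Lemma expi0 (R : realType) : expi (0 : R) = 1.
Proof. by rewrite /expi cos0 sin0. Qed.

(** Subtracting the floor reduces to [0 <= f < 1]. The real part gives cos (2 pi f) = 1, so sin (pi
    f) = 0 by the double-angle formula; as sin is positive strictly between 0 and pi, only f = 0
    remains. *)
Lemma expi_eq1 (R : realType) (t : R) : expi (2 * pi * t) = 1 -> t \is a Num.int.
Proof.
move=> e1; pose f := t - (Num.floor t)%:~R.
have fE : expi (2 * pi * f) = 1.
  by rewrite -e1; apply: expi_int; rewrite /f addrAC subrr add0r rpredN intr_int.
have /andP[f0 f1] : 0 <= f < 1.
  by rewrite /f subr_ge0 ltrBlDl -intrD1 floor_itv.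
have : cos ((pi * f) *+ 2) = 1.
  by move/eqP: fE; rewrite -mulrnAl -[pi *+ 2]mulr_natl eq_complex => /andP[/eqP].
rewrite cos_mulr2n => c1.
have s0 : sin (pi * f) = 0.
  by apply/eqP; rewrite -sqrf_eq0 sin2cos2; apply/eqP; lra.
have [f00|fn0] := eqVneq f 0.
  by rewrite -(subrK (Num.floor t)%:~R t) -/f f00 add0r intr_int.
have fp : 0 < f by rewrite lt_neqAle eq_sym fn0.
have := @sin_gt0_pi R (pi * f).
by rewrite s0 ltxx mulr_gt0 ?pi_gt0 // gtr_pMr ?pi_gt0 // f1 => /(_ isT).
Qed.

(** Through this identity, every fact about tori of lattice bases transfers to dual tori. *)
Lemma dual_torusE (R : realType) (n : nat) (A Z : 'M[R]_n) :
  A \in unitmx -> Z \in unitmx ->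
  dual_torus A Z = torus (invmx Z)^T (invmx A)^T.
Proof. by move=> uA uZ; rewrite /dual_torus !dual_lattice. Qed.

Lemma lattice0 (R : realType) (n : nat) (A : 'M[R]_n) : lattice A 0.
Proof. by exists 0 => //; rewrite map_mx0 mulmx0. Qed.

Section Torus.
Variables (R : realType) (n : nat) (A Z : 'M[R]_n).
Hypotheses (uA : A \in unitmx) (uZ : Z \in unitmx).
Hypothesis ZA : lattice Z `<=` lattice A.

Lemma torus_rep (X : torus A Z) :
  lattice A (rep (val X)) /\
  val X = [set rep (val X) + z | z in lattice Z].
Proof.
have QX : quotient (lattice A) (lattice Z) (val X).
  by rewrite -set_torus //; exact: (valP X).
have [x Ax xX] := QX.
have Xx : val X x by rewrite -xX; exists 0; [exact: lattice0|rewrite addr0].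
have dX := coset_rep QX Xx.
split; last by rewrite (coset_eq dX) xX.
by rewrite -(subrK x (rep _)); apply: lattice_add => //; exact: ZA.
Qed.

Lemma torus_inj (X Y : torus A Z) :
  lattice Z (rep (val X) - rep (val Y)) -> X = Y.
Proof.
move=> /coset_eq XY; apply: val_inj => /=.
by rewrite (torus_rep X).2 (torus_rep Y).2.
Qed.

Lemma torus_class (x : 'cV[R]_n) : lattice A x ->
  exists X : torus A Z, lattice Z (rep (val X) - x).
Proof.
move=> Ax; have Q : quotient (lattice A) (lattice Z) [set x + z | z in lattice Z].
  by exists x.
have T : [set x + z | z in lattice Z] \in torus A Z.
  by move: Q; rewrite -set_torus.
exists [` T]%fset; apply: (coset_rep Q).
by exists 0; [exact: lattice0|rewrite addr0].
Qed.

Lemma sum_expi_eq0 (k : 'cV[R]_n) :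
  dual (lattice Z) k -> ~ dual (lattice A) k ->
  \sum_(X : torus A Z) expi (2 * pi * dotv k (rep (val X))) = 0.
Proof.
move=> Zk /existsNP[a /not_implyP[Aa ka]].
(* [tau] is translation by [a] on the classes. *)
have /choice[tau tauE] : forall X : torus A Z, exists Y : torus A Z,
    lattice Z (rep (val Y) - (rep (val X) + a)).
  by move=> X; apply: torus_class; apply: lattice_add => //; exact: (torus_rep X).1.
have tauI : injective tau.
  (* Subtracting the relations that define [tau Y] and [tau X] cancels [a] and the common image. *)
  move=> X Y XY; apply: torus_inj.
  have := lattice_sub (tauE Y) (tauE X); rewrite XY opprB addrC addrA subrK.
  by rewrite opprD addrACA subrr addr0.
set S := LHS.
have SE : S = expi (2 * pi * dotv k a) * S.
  rewrite {1}/S (reindex_inj tauI) mulr_sumr; apply: eq_bigr => X _.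
  (* The representative of [tau X] differs from that of [X] plus [a] by a point of L(Z), on which
     [k] is integral. *)
  rewrite -expiD -mulrDr; apply: expi_int.
  by rewrite -dotvDr -dotvBr [a + _]addrC; exact: Zk.
(* If S were nonzero, cancelling it in [SE] would make the factor 1 and <k, a> an integer. *)
apply: contrapT => /eqP S0; apply: ka; apply: expi_eq1.
by apply: (mulIf S0); rewrite -SE mul1r.
Qed.

End Torus.

Section Waves.
Variables (R : realType) (n m : nat) (A Z : 'M[R]_n) (s : m.-tuple 'cV[R]_n).
Hypotheses (uA : A \in unitmx) (uZ : Z \in unitmx).
Hypothesis ZA : lattice Z `<=` lattice A.

Lemma dual_torus_rep (K : dual_torus A Z) : dual (lattice Z) (rep (val K)).
Proof.
have := dual_sub ZA; move: K; rewrite dual_torusE // !dual_lattice // => K AZ.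
by apply: (torus_rep _ _ _ K).1; rewrite ?unitmx_tr ?unitmx_inv.
Qed.

Lemma dual_torus_inj (K K' : dual_torus A Z) :
  dual (lattice A) (rep (val K) - rep (val K')) -> K = K'.
Proof.
have := dual_sub ZA; move: K K'; rewrite dual_torusE // !dual_lattice // => K K' AZ.
by apply: torus_inj; rewrite ?unitmx_tr ?unitmx_inv.
Qed.

Lemma card_torus_gt0 : (0 < #|` torus A Z|)%N.
Proof.
have [X _] := torus_class uA uZ ZA (lattice0 A).
by rewrite cardfE; apply/card_gt0P; exists X.
Qed.

Lemma wave_orthonormal (p q : 'I_m * dual_torus A Z) :
  crystal_dot (wave s p.1 p.2) (wave s q.1 q.2) = (p == q)%:R.
Proof.
case: p q => [l K] [l' K'] /=.
pose d := rep (val K) - rep (val K').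
(* Conjugation negates the exponent, so the product of two waves in the same component is the
   character of the difference [d]. *)
have -> : crystal_dot (wave s l K) (wave s l' K') =
    (l == l')%:R * (#|` torus A Z|%:R^-1 *
    \sum_(X : torus A Z) expi (2 * pi * dotv d (rep (val X)))).
  rewrite /crystal_dot [RHS]mulrCA; congr (_ * _).
  rewrite mulr_sumr; apply: eq_bigr => X _.
  rewrite (bigD1 l) //= big1 ?addr0; last first.
    by move=> j /negbTE jl; rewrite !ffunE !mxE jl mul0r.
  rewrite !ffunE !mxE eqxx; case: eqP => [_|_]; last by rewrite conjC0 mulr0 mul0r.
  rewrite mul1r expi_conj -expiD -mulrN -mulrDr.
  by rewrite [dotv d _]dotvC dotvBr !(dotvC (rep (val X))).
rewrite xpair_eqE; case: (l == l'); rewrite ?mul0r // mul1r /=.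
have cT : #|` torus A Z|%:R != 0 :> R[i] by rewrite pnatr_eq0 -lt0n card_torus_gt0.
have [KK|KK] := eqVneq K K'.
  rewrite (eq_bigr (fun=> 1)) => [|X _].
    by rewrite sumr_const -cardfE mulVf.
  by rewrite /d KK subrr dotvC dotvE mulmx0 mxE mulr0 expi0.
(* [d] lies in the dual of L(Z), and distinct classes keep it out of the dual of L(A). *)
rewrite sum_expi_eq0 ?mulr0 //.
  move=> x Zx; rewrite dotvC dotvBr !(dotvC x).
  by apply: rpredB; exact: dual_torus_rep Zx.
by move=> /dual_torus_inj /eqP; rewrite (negbTE KK).
Qed.

Lemma crystal_dot_suml (I : finType) (c : I -> R[i])
    (f : I -> crystal_fun A Z s) (g : crystal_fun A Z s) :
  crystal_dot (\sum_i c i *: f i) g = \sum_i c i * crystal_dot (f i) g.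
Proof.
rewrite /crystal_dot; under [RHS]eq_bigr => i _ do rewrite mulrCA mulr_sumr.
rewrite -mulr_sumr [in RHS]exchange_big /=; congr (_ * _); apply: eq_bigr => X _.
under [RHS]eq_bigr => i _ do rewrite mulr_sumr.
rewrite [in RHS]exchange_big /=; apply: eq_bigr => l _.
rewrite sum_ffunE summxE mulr_suml; apply: eq_bigr => i _.
by rewrite !ffunE !mxE mulrA.
Qed.

(** Pairing a vanishing combination with the [i]-th wave isolates its [i]-th coefficient. *)
Lemma wave_free :
  free [seq wave s p.1 p.2 | p : 'I_m * dual_torus A Z].
Proof.
apply/(@freeP _ _ _ (codom_tuple (fun p => wave s p.1 p.2))) => c c0 i.
have := crystal_dot_suml c
  (fun i : 'I_#|{: 'I_m * dual_torus A Z}| =>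
     wave s (enum_val i).1 (enum_val i).2)
  (wave s (enum_val i).1 (enum_val i).2).
rewrite [X in _ = X](bigD1 i) //= [X in _ = _ + X]big1 => [|j ji]; last first.
  by rewrite wave_orthonormal (inj_eq enum_val_inj) (negbTE ji) mulr0.
rewrite wave_orthonormal eqxx mulr1 addr0 => <-.
(* [c0] is stated with entries of the codomain tuple, so the waves are put in that form. *)
under eq_bigr => j _ do rewrite -(nth_codom 0 (fun p => wave s p.1 p.2)).
rewrite c0 /crystal_dot big1 ?mulr0 // => X _.
by rewrite big1 // => j _; rewrite ffunE mxE mul0r.
Qed.

Lemma dim_crystal_fun :
  \dim (fullv : {vspace crystal_fun A Z s}) = (m * #|` torus A Z|)%N.
(* The dimension unfolds to the number of classes times [1 * m], the size of a row vector. *)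
Proof. by rewrite dimvf cardfE mulnC -[m in RHS]mul1n. Qed.

Lemma size_waves :
  size [seq wave s p.1 p.2 | p : 'I_m * dual_torus A Z] =
  (m * #|` dual_torus A Z|)%N.
Proof. by rewrite size_map -cardE card_prod card_ord cardfE. Qed.

End Waves.

Lemma leq_card_dual_torus (R : realType) (n : nat) (A Z : 'M[R]_n) :
  A \in unitmx -> Z \in unitmx -> lattice Z `<=` lattice A ->
  (#|` dual_torus A Z| <= #|` torus A Z|)%N.
Proof.
move=> uA uZ ZA; pose s := [tuple 0 : 'cV[R]_n].
(* With a single structure point, the waves are indexed by the dual torus alone and the space has
   dimension |T|. *)
have := dimvS (subvf <<[seq wave s p.1 p.2 | p : 'I_1 * dual_torus A Z]>>).
have /eqP-> := wave_free s uA uZ ZA.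
by rewrite size_waves (dim_crystal_fun A Z s) !mul1n.
Qed.

(* The reverse inequality is the same bound for [(Z^-T, A^-T)], whose torus and
   dual torus are the dual torus and the torus of [(A, Z)]. *)
Lemma card_dual_torus (R : realType) (n : nat) (A Z : 'M[R]_n) :
  A \in unitmx -> Z \in unitmx -> lattice Z `<=` lattice A ->
  #|` dual_torus A Z| = #|` torus A Z|.
Proof.
move=> uA uZ ZA; apply/eqP; rewrite eqn_leq leq_card_dual_torus //=.
have := dual_sub ZA; rewrite !dual_lattice // => AZ.
have uA' : (invmx A)^T \in unitmx by rewrite unitmx_tr unitmx_inv.
have uZ' : (invmx Z)^T \in unitmx by rewrite unitmx_tr unitmx_inv.
have := leq_card_dual_torus uZ' uA' AZ.
by rewrite !dual_torusE // -!trmx_inv !trmxK !invmxK.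
Qed.

Theorem theorem3p2 (R : realType) (n m : nat) (A Z : 'M[R]_n)
    (s : m.-tuple 'cV[R]_n)
    (hA : A \in unitmx) (hZ : Z \in unitmx)
    (hZA : lattice Z `<=` lattice A)
    (hs : structure_element A s) :
  let e (p : 'I_m * dual_torus A Z) : crystal_fun A Z s := wave s p.1 p.2 in
  (forall p q, crystal_dot (e p) (e q) = (p == q)%:R) /\
  basis_of fullv [seq e p | p : 'I_m * dual_torus A Z].
Proof.
split=> [p q|]; first exact: wave_orthonormal.
(* A free family with at least as many members as the dimension is a basis. *)
rewrite basisEfree wave_free // subvf size_waves (dim_crystal_fun A Z s).
by rewrite card_dual_torus //= leqnn.
Qed.
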